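(* For all integers $m,n\geq3$, \[5\leq\mathrm{pmd}(C_m\square C_n)\leq6.\] In addition, $\mathrm{pmd}(C_m\square C_n)=5$ if $m+n$ is odd and $\{m,n\}\neq\{3,4\},\{3,6\},\{5,6\}$.
   Context: All graphs are finite and simple. $C_n$ is the cycle on $n$ vertices. A set $M\subseteq E$ of edges of a graph $\Gamma=(V,E)$ is a matching if its edges are pairwise disjoint. A matching $M$ is positive (in $\Gamma$) if there is a weight function $w\colon V\to\mathbb{R}$ such that for every edge $uv\in E$: $w(u)+w(v)>0$ if and only if $uv\in M$. A positive matching decomposition (pmd) of $\Gamma$ with $p$ parts is an ordered partition $E_1,\ldots,E_p$ of $E$ such that $E_i$ is a positive matching of the graph $(V,E\setminus\bigcup_{j=1}^{i-1}E_j)$ for $i=1,\ldots,p$. $\mathrm{pmd}(\Gamma)$ denotes the smallest $p$ for which $\Gamma$ has a pmd with $p$ parts. The Cartesian product $\Gamma_1\square\Gamma_2$ has vertex set $V(\Gamma_1)\times V(\Gamma_2)$, with $(a_1,a_2)\sim(b_1,b_2)$ if either $a_1=b_1$ and $a_2\sim b_2$, or $a_1\sim b_1$ and $a_2=b_2$. *)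

(* Defs.v *)
From HB Require Import structures.
From mathcomp Require Import all_boot all_order all_algebra.
From mathcomp Require Import boolp reals.

Set Implicit Arguments.
Unset Strict Implicit.
Unset Printing Implicit Defensive.

Import Order.TTheory GRing.Theory Num.Theory.

Record sgraph (V : finType) := SGraph {
  adj : rel V;
  adj_sym : symmetric adj;
  adj_irr : irreflexive adj
}.

Definition edges (V : finType) (G : sgraph V) : {set {set V}} :=
  [set [set u; v] | u in V, v in V & adj G u v].

Section DelEdges.
Variables (V : finType) (G : sgraph V) (F : {set {set V}}).

Definition del_adj : rel V :=
  [rel u v | adj G u v && ([set u; v] \notin F)].

Lemma del_adj_sym : symmetric del_adj.
Proof. by move=> u v; rewrite /del_adj /= adj_sym setUC. Qed.

Lemma del_adj_irr : irreflexive del_adj.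
Proof. by move=> u; rewrite /del_adj /= adj_irr. Qed.

Definition del_edges : sgraph V := SGraph del_adj_sym del_adj_irr.

End DelEdges.

Definition matching (V : finType) (G : sgraph V) (M : {set {set V}}) : bool :=
  (M \subset edges G) && trivIset M.

Definition positive_matching (R : realType) (V : finType) (G : sgraph V)
    (M : {set {set V}}) : Prop :=
  matching G M /\
  exists w : V -> R, forall u v : V, adj G u v ->
    ((0 < w u + w v)%R <-> [set u; v] \in M).

(* [partition] excludes empty parts, and injectivity of [E_] prevents a part
   from being listed twice. *)
Definition is_pmd (R : realType) (V : finType) (G : sgraph V) (p : nat)
    (E_ : 'I_p -> {set {set V}}) : Prop :=
  [/\ injective E_,
      partition [set E_ i | i : 'I_p] (edges G)
    & forall i : 'I_p,
        positive_matching R (del_edges G (\bigcup_(j < p | j < i) E_ j)) (E_ i)].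

Definition has_pmd (R : realType) (V : finType) (G : sgraph V) (p : nat) : Prop :=
  exists E_ : 'I_p -> {set {set V}}, is_pmd R G E_.

Lemma edgesP (V : finType) (G : sgraph V) (e : {set V}) :
  reflect (exists u v, adj G u v /\ e = [set u; v]) (e \in edges G).
Proof.
apply: (iffP imset2P) => [[u v _]|[u [v [uv ->]]]].
  by rewrite inE => uv ->; exists u, v.
by exists u v; rewrite ?inE.
Qed.

Lemma mem_edges (V : finType) (G : sgraph V) (u v : V) :
  ([set u; v] \in edges G) = adj G u v.
Proof.
apply/edgesP/idP => [[x [y [xy e]]]|uv]; last by exists u, v.
have xDy : x != y by apply: contraTneq xy => ->; rewrite adj_irr.
have : x \in [set u; v] by rewrite e set21.
have : y \in [set u; v] by rewrite e set22.
rewrite !inE => /orP[]/eqP yE /orP[]/eqP xE; subst x y => //.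
- by rewrite eqxx in xDy.
- by rewrite adj_sym.
- by rewrite eqxx in xDy.
Qed.

(* The one-edge parts, in any order, form a pmd. *)
Lemma has_pmd_card_edges (R : realType) (V : finType) (G : sgraph V) :
  has_pmd R G #|edges G|.
Proof.
pose E_ (i : 'I_#|edges G|) : {set {set V}} := [set enum_val i].
have injE : injective E_ by move=> i j /set1_inj /enum_val_inj.
exists E_; split=> // [|i].
  apply/and3P; split.
  - apply/eqP/setP => e; apply/bigcupP/idP => [[_ /imsetP[i _ ->]]|eG].
      by rewrite inE => /eqP ->; apply: enum_valP.
    exists (E_ (enum_rank_in eG e)); first exact: imset_f.
    by rewrite inE enum_rankK_in.
  - apply/trivIsetP => _ _ /imsetP[i _ ->] /imsetP[j _ ->] ij.
    rewrite disjoints1 inE; apply: contra ij => /eqP ij.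
    by rewrite /E_ ij.
  - apply/imsetP => -[i _ /setP/(_ (enum_val i))].
    by rewrite !inE eqxx.
have [u [v [uv eE]]] := edgesP _ _ (enum_valP i).
set H := del_edges _ _.
have uvH : adj H u v.
  rewrite /H /= /del_adj /= uv; apply/negP => /bigcupP[j ji].
  rewrite inE -eE => /eqP/enum_val_inj ij.
  by rewrite ij ltnn in ji.
split.
  rewrite /matching sub1set eE mem_edges uvH /=.
  by apply/trivIsetP => A B /set1P -> /set1P ->; rewrite eqxx.
exists (fun x => if x \in [set u; v] then 1%R else (- 2%:R)%R) => x y xyH.
rewrite /E_ in_set1 eE.
have xDy : x != y by apply: contraTneq xyH => ->; rewrite adj_irr.
have -> : ([set x; y] == [set u; v]) = (x \in [set u; v]) && (y \in [set u; v]).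
  apply/eqP/andP => [<-|[]]; first by rewrite set21 set22.
  rewrite !inE => /orP[]/eqP xE /orP[]/eqP yE; subst x y => //.
  - by rewrite eqxx in xDy.
  - by rewrite setUC.
  - by rewrite eqxx in xDy.
have lt1 : (1 - 2%:R < 0 :> R)%R by rewrite subr_lt0 ltr1n.
case: (x \in _); case: (y \in _) => /=; split=> //.
- by rewrite addr_gt0.
- by rewrite ltNge ltW.
- by rewrite addrC ltNge ltW.
- by rewrite -opprD oppr_gt0 ltNge addr_ge0.
Qed.

Lemma ex_has_pmd (R : realType) (V : finType) (G : sgraph V) :
  exists p, `[< has_pmd R G p >].
Proof. by exists #|edges G|; apply/asboolP/has_pmd_card_edges. Qed.

Definition pmd (R : realType) (V : finType) (G : sgraph V) : nat :=
  ex_minn (ex_has_pmd R G).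

Section CycleGraph.
Variable n : nat.

(* [ordS] is the successor modulo [n]; the condition [i != j] only matters for
   [n = 1]. *)
Definition cycle_adj : rel 'I_n :=
  [rel i j | (i != j) && ((j == ordS i) || (i == ordS j))].

Lemma cycle_adj_sym : symmetric cycle_adj.
Proof. by move=> i j; rewrite /cycle_adj /= eq_sym orbC. Qed.

Lemma cycle_adj_irr : irreflexive cycle_adj.
Proof. by move=> i; rewrite /cycle_adj /= eqxx. Qed.

Definition cycle_graph : sgraph 'I_n := SGraph cycle_adj_sym cycle_adj_irr.

End CycleGraph.

Section CartesianProduct.
Variables (V1 V2 : finType) (G1 : sgraph V1) (G2 : sgraph V2).

Definition cart_adj : rel (V1 * V2) :=
  [rel a b | (a.1 == b.1) && adj G2 a.2 b.2 || adj G1 a.1 b.1 && (a.2 == b.2)].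

Lemma cart_adj_sym : symmetric cart_adj.
Proof.
by move=> a b; rewrite /cart_adj /= (eq_sym a.1) (eq_sym a.2) (adj_sym G1) (adj_sym G2).
Qed.

Lemma cart_adj_irr : irreflexive cart_adj.
Proof. by move=> a; rewrite /cart_adj /= !adj_irr !andbF. Qed.

Definition cart_prod : sgraph (V1 * V2)%type := SGraph cart_adj_sym cart_adj_irr.

End CartesianProduct.

(* Main.v *)
(** An edge colouring with [p] colours in which every colour class, with its
    weights, is positive among the edges of the same or a later colour is a
    positive matching decomposition with at most [p] parts.  Such a colouring
    of [C_m □ C_n] can be read off a finite table: give rows and columns types
    by closed walks of lengths [m] and [n] in two small digraphs, and let
    colours and weights depend only on the types.  Loops of lengths 3, 5, 7
    for the rows and 4, 6 for the columns allow 5 colours, which handles all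
    odd [m] and even [n]; loops of lengths 3, 4, 5 on both sides allow 6.

    Conversely, if a [d]-regular graph had at most [d] parts, then every part
    would be a perfect matching.  With [w] the weights of the first part,
    summing [w u + w v] over its edges [uv] gives [sum w > 0], while summing
    over all other edges gives [(d - 1) sum w <= 0]. *)
Require Import Defs.
From mathcomp Require Import all_boot all_order all_algebra.
From mathcomp Require Import boolp reals.

Import Order.TTheory GRing.Theory Num.Theory.

Set Implicit Arguments.
Unset Strict Implicit.
Unset Printing Implicit Defensive.

(** * Lower bound for regular graphs *)

Lemma set2_injr (T : finType) (u v v' : T) :
  [set u; v] = [set u; v'] -> v = v'.
Proof.
move=> e; have : v \in [set u; v'] by rewrite -e set22.
rewrite !inE => /orP[]/eqP // vE; subst v.
have : v' \in [set u; u] by rewrite e set22.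
by rewrite !inE orbb => /eqP.
Qed.

Section Regular.
Variables (R : realType) (V : finType).

(** Each weight is counted [c] times as the outer vertex and, [r] being symmetric, [c] times as the
    inner one. *)
Lemma sum_regular (r : rel V) (c : nat) (w : V -> R) :
  symmetric r -> (forall v, #|[pred u | r v u]| = c) ->
  (\sum_v \sum_(u | r v u) (w v + w u) = (\sum_v w v) *+ (c + c))%R.
Proof.
move=> rC rc.
have swL : (\sum_v \sum_(u | r v u) w v = (\sum_v w v) *+ c)%R.
  by rewrite -sumrMnl; apply: eq_bigr => v _; rewrite sumr_const rc.
have swR : (\sum_v \sum_(u | r v u) w u = (\sum_v w v) *+ c)%R.
  rewrite -swL (exchange_big_dep predT) //=.
  by apply: eq_bigr => v _; apply: eq_bigl => u; rewrite rC.
rewrite mulrnDr -{1}swL -swR -big_split /=.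
by apply: eq_bigr => v _; rewrite big_split.
Qed.

Lemma pmd_regular (G : sgraph V) (d : nat) (v0 : V) :
  1 < d -> (forall v, #|[pred u | adj G v u]| = d) -> d < pmd R G.
Proof.
move=> d_gt1 regG; rewrite /pmd; case: ex_minnP => p /asboolP[E_ [_ partE posE]] _.
rewrite ltnNge; apply/negP => le_pd.
have edgeE u v : adj G u v -> exists i, [set u; v] \in E_ i.
  rewrite -mem_edges -(cover_partition partE) => /bigcupP[_ /imsetP[i _ ->]].
  by exists i.
have [u0 v0u0] : exists u, adj G v0 u.
  have /card_gt0P[u] : 0 < #|[pred u | adj G v0 u]|.
    by rewrite regG (ltn_trans _ d_gt1).
  by exists u.
have [i1 _] := edgeE _ _ v0u0.
have p_gt0 : 0 < p by apply: leq_ltn_trans (ltn_ord i1).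
pose i0 := Ordinal p_gt0.
have uniqE i v u u' : [set v; u] \in E_ i -> [set v; u'] \in E_ i -> u = u'.
  have [/andP[_ /trivIsetP tE] _] := posE i.
  move=> uE u'E; have [/set2_injr //|neq] := eqVneq [set v; u] [set v; u'].
  have := tE _ _ uE u'E neq.
  by rewrite disjoints_subset => /subsetP/(_ v); rewrite !inE eqxx => /(_ isT).
(* The part containing the edge [vu]; the default [i0] is never reached on edges. *)
pose f v u := odflt i0 [pick i | [set v; u] \in E_ i].
have fP v u : adj G v u -> [set v; u] \in E_ (f v u).
  move=> /edgeE[i iE]; rewrite /f; case: pickP => // /(_ i).
  by rewrite iE.
have f_inj v : {in [pred u | adj G v u] &, injective (f v)}.
  move=> u u'; rewrite !inE => vu vu' fE; apply: (uniqE (f v u) v); first exact: fP.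
  by rewrite fE; apply: fP.
(* The [d] edges at [v] lie in [d] different parts and [p <= d], so every part, in particular the
   first, meets [v]. *)
have perfect v : exists2 u, adj G v u & [set v; u] \in E_ i0.
  have cardf : #|[set f v u | u in [pred u | adj G v u]]| = d.
    by rewrite card_in_imset ?regG //; apply: f_inj.
  have : i0 \in [set f v u | u in [pred u | adj G v u]].
    have /eqP -> : [set f v u | u in [pred u | adj G v u]] == [set: 'I_p].
      by rewrite eqEcard subsetT cardsT card_ord cardf le_pd.
    by rewrite inE.
  case/imsetP => u; rewrite inE => vu i0E; exists u => //.
  by rewrite i0E; apply: fP.
have [_ [w wP]] := posE i0.
have {}wP u v : adj G u v -> (0 < w u + w v)%R <-> [set u; v] \in E_ i0.
  (* No part precedes [i0], so nothing has been deleted yet. *)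
  move=> uv; apply: wP; rewrite /= /del_adj /= uv big_pred0 ?inE //.
pose r1 := [rel u v | adj G u v && ([set u; v] \in E_ i0)].
pose r2 := [rel u v | adj G u v && ([set u; v] \notin E_ i0)].
have r1C : symmetric r1 by move=> u v; rewrite /= adj_sym setUC.
have r2C : symmetric r2 by move=> u v; rewrite /= adj_sym setUC.
have r1d v : #|[pred u | r1 v u]| = 1.
  have [u vu uE] := perfect v; rewrite -(card1 u); apply: eq_card => u'.
  rewrite !inE /=; apply/andP/eqP => [[_ u'E]|->]; last by rewrite vu.
  exact: (uniqE i0 v).
have r2d v : #|[pred u | r2 v u]| = d.-1.
  rewrite -(regG v) -(cardID [pred u | r1 v u] [pred u | adj G v u]).
  rewrite (@eq_card _ [predI _ & _] [pred u | r1 v u]) ?r1d ?add1n.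
    apply: eq_card => u; rewrite !inE /=.
    by case: (adj G v u); rewrite ?andbF ?andbT //=.
  by move=> u; rewrite !inE /= andbA andbb.
have := sum_regular w r1C r1d; have := sum_regular w r2C r2d.
set S := (\sum_v w v)%R => S2 S1.
have : (0 < S *+ (1 + 1))%R.
  rewrite -S1 (bigD1 v0) //=; apply: ltr_wpDr.
    apply: sumr_ge0 => v _; apply: sumr_ge0 => u /andP[vu vuE].
    by apply/ltW/wP.
  have [u vu uE] := perfect v0; rewrite (bigD1 u) /=; last by rewrite vu.
  apply: ltr_wpDr; last exact/wP.
  by apply: sumr_ge0 => u' /andP[/andP[vu' u'E] _]; apply/ltW/wP.
rewrite pmulrn_lgt0 // => S_gt0.
have : (S *+ (d.-1 + d.-1) <= 0)%R.
  rewrite -S2; apply: sumr_le0 => v _; apply: sumr_le0 => u /andP[vu vuE].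
  by rewrite leNgt; apply: contra vuE => /wP; apply.
by rewrite leNgt pmulrn_lgt0 ?S_gt0 // addn_gt0 -subn1 subn_gt0 d_gt1.
Qed.

End Regular.

(** * From edge colourings to decompositions *)

Section Coloring.
Variable R : realType.

(** The bound [k <= c u v] selects the edges that survive the deletion of the colours below [k].
    Unlike parts, colour classes may be empty. *)
Definition pmd_coloring (V : finType) (G : sgraph V) (p : nat)
    (c : V -> V -> nat) (w : nat -> V -> R) : Prop :=
  [/\ forall u v, adj G u v -> c u v = c v u,
      forall u v, adj G u v -> c u v < p,
      forall u v v', adj G u v -> adj G u v' -> c u v = c u v' -> v = v'
    & forall u v k, adj G u v -> k <= c u v ->
        (0 < w k u + w k v)%R = (c u v == k)].

Lemma pmd_coloring_pullback (V V' : finType) (G : sgraph V) (G' : sgraph V')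
    (f : V' -> V) p c w :
  injective f -> (forall u v, adj G' u v -> adj G (f u) (f v)) ->
  pmd_coloring G p c w ->
  pmd_coloring G' p (fun u v => c (f u) (f v)) (fun k => w k \o f).
Proof.
move=> f_inj fG [cC c_lt c_inj wP].
split=> [u v /fG|u v /fG|u v v' /fG uv /fG uv'|u v k /fG] /=.
- exact: cC.
- exact: c_lt.
- by move/(c_inj _ _ _ uv uv')/f_inj.
- exact: wP.
Qed.

Variables (V : finType) (G : sgraph V).

Lemma pmd_coloring_drop p k c w :
  pmd_coloring G p.+1 c w -> k <= p -> (forall u v, adj G u v -> c u v != k) ->
  pmd_coloring G p (fun u v => unbump k (c u v)) (fun j => w (bump k j)).
Proof.
move=> [cC c_lt c_inj wP] le_kp cDk.
have cE u v : adj G u v -> bump k (unbump k (c u v)) = c u v.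
  by move=> uv; apply: unbumpK; rewrite !inE cDk.
split=> [u v uv|u v uv|u v v' uv uv' e|u v j uv le_j].
- by rewrite cC.
- rewrite ltnNge -(leq_bump2 k) cE // -ltnNge.
  apply: leq_trans (c_lt _ _ uv) _.
  by rewrite /bump le_kp.
- by apply: (c_inj u) => //; rewrite -cE // e cE.
- rewrite -(leq_bump2 k) cE // in le_j.
  rewrite wP // -{1}(cE _ _ uv); apply/eqP/eqP => [|->] //; exact: can_inj (bumpK k) _ _.
Qed.

(** When every colour occurs, the classes are nonempty and distinct, as [is_pmd] demands. *)
Lemma pmd_coloring_onto p c w :
  pmd_coloring G p c w ->
  (forall k : 'I_p, exists u v, adj G u v /\ c u v = k) -> has_pmd R G p.
Proof.
move=> [cC c_lt c_inj wP] c_onto.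
pose E_ (k : 'I_p) : {set {set V}} :=
  [set [set u; v] | u in V, v in V & adj G u v && (c u v == k)].
have EP k u v : adj G u v -> ([set u; v] \in E_ k) = (c u v == k).
  move=> uv; apply/imset2P/idP => [[x y _]|ck].
    rewrite inE => /andP[_ /andP[xy /eqP <-]] e.
    have uDv : u != v by apply: contraTneq uv => ->; rewrite adj_irr.
    have : u \in [set x; y] by rewrite -e set21.
    have : v \in [set x; y] by rewrite -e set22.
    rewrite !inE => /orP[]/eqP vE /orP[]/eqP uE; subst u v => //.
    - by rewrite eqxx in uDv.
    - by rewrite cC.
    - by rewrite eqxx in uDv.
  by exists u v; rewrite ?inE ?uv.
have Eedge k e : e \in E_ k -> exists u v, [/\ adj G u v, e = [set u; v] & c u v = k].
  by case/imset2P => u v _; rewrite inE => /andP[_ /andP[uv /eqP ck]] ->; exists u, v.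
exists E_; split=> [k l ekl|| k].
- have [u [v [uv ck]]] := c_onto k; apply/val_inj; rewrite /= -ck.
  by apply/eqP; rewrite -EP // -ekl EP // ck.
- apply/and3P; split.
  + apply/eqP/setP => e; apply/bigcupP/edgesP.
      by case=> _ /imsetP[k _ ->] /Eedge[u [v [uv -> _]]]; exists u, v.
    case=> u [v [uv ->]]; exists (E_ (Ordinal (c_lt _ _ uv))); first exact: imset_f.
    by rewrite EP.
  + apply/trivIsetP => _ _ /imsetP[k _ ->] /imsetP[l _ ->]; apply: contraR.
    case/pred0Pn => e /andP[/= /Eedge[u [v [uv -> ck]]]].
    by rewrite EP // ck => /eqP/val_inj ->.
  + apply/imsetP => -[k _ Ek0]; have [u [v [uv ck]]] := c_onto k.
    by have := EP k u v uv; rewrite -Ek0 inE ck eqxx.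
have delP u v : adj (del_edges G (\bigcup_(j < p | j < k) E_ j)) u v ->
    adj G u v /\ k <= c u v.
  rewrite /= /del_adj /= => /andP[uv notin]; split=> //; rewrite leqNgt.
  apply: contra notin => lt_ck; apply/bigcupP.
  exists (Ordinal (c_lt _ _ uv)) => //.
  by rewrite EP.
split; last first.
  exists (w k) => u v /delP[uv le_k]; rewrite wP // EP //.
apply/andP; split.
  apply/subsetP => e /Eedge[u [v [uv -> ck]]]; rewrite mem_edges /= /del_adj /= uv /=.
  apply/negP => /bigcupP[j lt_jk]; rewrite EP // ck => /eqP kj.
  by rewrite kj ltnn in lt_jk.
apply/trivIsetP => A B AE BE; apply: contraR => /pred0Pn[x /andP[/= xA xB]].
have starE C : C \in E_ k -> x \in C -> exists y, [/\ adj G x y, C = [set x; y] & c x y = k].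
  case/Eedge => u [v [uv -> ck]]; rewrite !inE => /orP[]/eqP xE; subst x; first by exists v.
  by exists u; rewrite adj_sym setUC -cC.
have [y [xy -> cy]] := starE _ AE xA; have [z [xz -> cz]] := starE _ BE xB.
by rewrite (c_inj x y z) // cy cz.
Qed.

Lemma pmd_coloring_le p c w : pmd_coloring G p c w -> pmd R G <= p.
Proof.
have pmd_le q : has_pmd R G q -> pmd R G <= q.
  by move=> Gq; rewrite /pmd; case: ex_minnP => r _; apply; apply/asboolP.
elim: p c w => [|p IHp] c w col.
  by apply/pmd_le/(pmd_coloring_onto col) => -[].
have [onto|] := pselect (forall k : 'I_p.+1, exists u v, adj G u v /\ c u v = k).
  exact/pmd_le/(pmd_coloring_onto col).
move=> /existsNP[k kP]; apply/leqW/IHp/(pmd_coloring_drop (k := k) col).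
  by rewrite -ltnS.
by move=> u v uv; apply/eqP => ck; apply: kP; exists u, v.
Qed.

End Coloring.

Lemma uniq_map_in_inj (T1 T2 : eqType) (f : T1 -> T2) (s : seq T1) :
  uniq (map f s) -> {in s &, injective f}.
Proof.
elim: s => [|x s IHs] //= /andP[xs /IHs f_inj] y z; rewrite !inE.
case/predU1P => [->|ys] /predU1P[->|zs] // e; last exact: f_inj.
- by rewrite e map_f in xs.
- by rewrite -e map_f in xs.
Qed.

(** * Cycles and the neighbours of a torus vertex *)

Section CyclicSuccessor.
Variables (k : nat) (i : 'I_k).
Hypothesis k_ge3 : 3 <= k.

Lemma ordS_neq : (ordS i == i) = false.
Proof.
apply/negbTE; rewrite -val_eqE /=; have := ltn_ord i.
rewrite leq_eqVlt => /predU1P[e|lt_ik]; last by rewrite modn_small // gtn_eqF.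
by rewrite e modnn; apply: contraTneq k_ge3 => i0; rewrite -e -i0.
Qed.

Lemma ordS2_neq : (ordS (ordS i) == i) = false.
Proof.
apply/negbTE; rewrite -val_eqE /=; have := ltn_ord i.
rewrite leq_eqVlt => /predU1P[e|lt_ik].
  rewrite e modnn modn_small ?(leq_trans _ k_ge3) //.
  by apply: contraTneq k_ge3 => i0; rewrite -e -i0.
rewrite (modn_small lt_ik); move: lt_ik.
rewrite leq_eqVlt => /predU1P[e|lt_ik]; last first.
  by rewrite modn_small // gtn_eqF // ltnS leqnSn.
by rewrite e modnn; apply: contraTneq k_ge3 => i0; rewrite -e -i0.
Qed.

Lemma cycle_adjE (j : 'I_k) :
  adj (cycle_graph k) i j = (j == ord_pred i) || (j == ordS i).
Proof.
rewrite /= /cycle_adj /= orbC -(can2_eq (@ordSK k) (@ord_predK k)) (eq_sym (ordS j)).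
case: (eqVneq i j) => //= <-.
by rewrite (eq_sym i) ordS_neq.
Qed.

Lemma ordS_pred_neq : (ordS i == ord_pred i) = false.
Proof. by rewrite -(inj_eq (@ordS_inj k)) ord_predK ordS2_neq. Qed.

Lemma ord_pred_neq : (ord_pred i == i) = false.
Proof. by rewrite -(inj_eq (@ordS_inj k)) ord_predK eq_sym ordS_neq. Qed.

End CyclicSuccessor.

Definition torus_nbrs m n (u : 'I_m * 'I_n) : seq ('I_m * 'I_n) :=
  [:: (ord_pred u.1, u.2); (ordS u.1, u.2); (u.1, ord_pred u.2); (u.1, ordS u.2)].

Section Torus.
Variables m n : nat.
Hypotheses (hm : 3 <= m) (hn : 3 <= n).

Lemma mem_torus_nbrs (u v : 'I_m * 'I_n) :
  adj (cart_prod (cycle_graph m) (cycle_graph n)) u v = (v \in torus_nbrs u).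
Proof.
case: u v => [i j] [i' j']; transitivity
  ((i == i') && adj (cycle_graph n) j j' || adj (cycle_graph m) i i' && (j == j')) => //.
rewrite !cycle_adjE // !inE !xpair_eqE (eq_sym i) (eq_sym j) /=.
by do 6!case: eqP => _.
Qed.

(** Reduces symmetric statements to the arcs towards a successor, the only ones that the tables
    record. *)
Lemma torus_arc_ind (P : 'I_m * 'I_n -> 'I_m * 'I_n -> Prop) :
  (forall u v, P u v -> P v u) ->
  (forall i j, P (i, j) (ordS i, j)) -> (forall i j, P (i, j) (i, ordS j)) ->
  forall u v, adj (cart_prod (cycle_graph m) (cycle_graph n)) u v -> P u v.
Proof.
move=> PC P1 P2 [i j] v; rewrite mem_torus_nbrs !inE /=.
case/or4P => /eqP -> //.
- by apply: PC; rewrite -{2}(ord_predK i).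
- by apply: PC; rewrite -{2}(ord_predK j).
Qed.

Lemma uniq_torus_nbrs (u : 'I_m * 'I_n) : uniq (torus_nbrs u).
Proof.
case: u => i j; rewrite /torus_nbrs /= !inE !xpair_eqE /=.
rewrite !(eq_sym (ord_pred _) (ordS _)) !ordS_pred_neq // !ordS_neq //.
by rewrite !ord_pred_neq // andbF.
Qed.

Lemma pmd_torus_ge5 (R : realType) :
  5 <= pmd R (cart_prod (cycle_graph m) (cycle_graph n)).
Proof.
have m_gt0 : 0 < m by apply: leq_trans hm.
have n_gt0 : 0 < n by apply: leq_trans hn.
apply: (pmd_regular _ (Ordinal m_gt0, Ordinal n_gt0)) => // v.
rewrite -[RHS](card_uniqP (uniq_torus_nbrs v)).
by apply: eq_card => u; rewrite inE mem_torus_nbrs.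
Qed.

End Torus.

(** * Colourings read off finite tables *)

(* Tables indexed by a row type and a column type: [hcol] and [vcol] colour the
   edges leaving a vertex towards its successor in its row and in its column.
   A natural number [x] in [wt] stands for the weight [x - bias]; the default
   values make the weight of every vertex 1 for the colours beyond [wt]. *)
Record scheme := Scheme {
  hcol : seq (seq nat);
  vcol : seq (seq nat);
  wt : seq (seq (seq nat));
  bias : nat
}.

Definition entry (t : seq (seq nat)) (a b : nat) : nat := nth 0 (nth [::] t a) b.

Section Scheme.
Variable S : scheme.

(** The last colour needs no table: only its own edges are left, so the constant weight 1 serves. *)
Definition weight (k a b : nat) : nat :=
  nth (bias S).+1 (nth [::] (nth [::] (wt S) k) a) b.

(** The sum of two weights shifted by [bias] is positive iff the entries add up to more than
    [(bias S).*2]. An edge of colour [c] is present exactly at the stages [0, ..., c]. *)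
Definition valid_edge (p c a b a' b' : nat) : bool :=
  (c < p) && all (fun k => ((bias S).*2 < weight k a b + weight k a' b') == (c == k))
                 (iota 0 c.+1).

(** Properness is tested at the common head [(a', b')] of the two arcs: the four entries colour the
    edges into and out of it. *)
Definition valid_scheme (p : nat) (ar ac : seq (nat * nat)) : bool :=
  all (fun '(a, a') => all (fun '(b, b') =>
    [&& valid_edge p (entry (vcol S) a b) a b a' b,
        valid_edge p (entry (hcol S) a b) a b a b'
      & uniq [:: entry (vcol S) a b'; entry (vcol S) a' b';
                 entry (hcol S) a' b; entry (hcol S) a' b']]) ac) ar.

End Scheme.

Definition closed_walk (arcs : seq (nat * nat)) (k : nat) (r : 'I_k -> nat) : Prop :=
  forall i, (r i, r (ordS i)) \in arcs.

Section SchemeColoring.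
Variables (R : realType) (S : scheme) (p : nat) (ar ac : seq (nat * nat)).
Variables (m n : nat) (r : 'I_m -> nat) (s : 'I_n -> nat).
Hypotheses (S_valid : valid_scheme S p ar ac) (hm : 3 <= m) (hn : 3 <= n).
Hypotheses (r_walk : closed_walk ar r) (s_walk : closed_walk ac s).

Let G := cart_prod (cycle_graph m) (cycle_graph n).

(** The end of a cycle edge whose successor is the other end; the tables store each colour there. *)
Definition arc_src k (i j : 'I_k) : 'I_k := if j == ordS i then i else j.

Definition scheme_color (u v : 'I_m * 'I_n) : nat :=
  if u.1 == v.1 then entry (hcol S) (r u.1) (s (arc_src u.2 v.2))
  else entry (vcol S) (r (arc_src u.1 v.1)) (s u.2).

Definition scheme_weight (k : nat) (u : 'I_m * 'I_n) : R :=
  ((weight S k (r u.1) (s u.2))%:R - (bias S)%:R)%R.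

Lemma scheme_color_nbrs u :
  map (scheme_color u) (torus_nbrs u) =
  [:: entry (vcol S) (r (ord_pred u.1)) (s u.2); entry (vcol S) (r u.1) (s u.2);
      entry (hcol S) (r u.1) (s (ord_pred u.2)); entry (hcol S) (r u.1) (s u.2)].
Proof.
rewrite /scheme_color /arc_src /= !eqxx !(eq_sym _ (ordS _)) !ordS_pred_neq //.
by rewrite (eq_sym u.1) ord_pred_neq // !ordS_neq.
Qed.

Lemma valid_arcs (i : 'I_m) (j : 'I_n) :
  [/\ valid_edge S p (entry (vcol S) (r i) (s j)) (r i) (s j) (r (ordS i)) (s j),
      valid_edge S p (entry (hcol S) (r i) (s j)) (r i) (s j) (r i) (s (ordS j))
    & uniq (map (scheme_color (i, j)) (torus_nbrs (i, j)))].
Proof.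
have validP i' j' := allP (allP S_valid _ (r_walk i')) _ (s_walk j').
have /and3P[-> -> _] := validP i j; split=> //.
(* The [uniq] test concerns the heads of the arcs, hence the predecessors. *)
have /and3P[_ _] := validP (ord_pred i) (ord_pred j).
by rewrite scheme_color_nbrs !ord_predK.
Qed.

Lemma scheme_pmd_coloring : pmd_coloring G p scheme_color scheme_weight.
Proof.
have edgeP u v : adj G u v ->
    scheme_color u v = scheme_color v u /\
    valid_edge S p (scheme_color u v) (r u.1) (s u.2) (r v.1) (s v.2).
  move: u v; apply: torus_arc_ind => // [u v [-> uv]|i j|i j].
  - split=> //; move: uv; rewrite /valid_edge => /andP[-> /allP uvP].
    by apply/allP => k /uvP; rewrite addnC.
  - have [iP _ _] := valid_arcs i j.
    rewrite /scheme_color /arc_src /= !(eq_sym i) ordS_neq // eqxx.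
    by rewrite ordS2_neq.
  - have [_ jP _] := valid_arcs i j.
    by rewrite /scheme_color /arc_src /= !eqxx (eq_sym j) ordS2_neq.
split=> [u v /edgeP[]|u v /edgeP[_ /andP[]]|u v v'|u v k /edgeP[_ /andP[_ /allP uvP]] le_k] //.
- rewrite !mem_torus_nbrs // => uv uv'.
  case: u uv uv' => i j uv uv'; have [_ _ /uniq_map_in_inj] := valid_arcs i j.
  exact.
- have /uvP/eqP <- : k \in iota 0 (scheme_color u v).+1 by rewrite mem_iota.
  by rewrite addrACA -opprD -!natrD subr_gt0 ltr_nat addnn.
Qed.

End SchemeColoring.

(** * Closed walks of prescribed length *)

Definition loop (arcs : seq (nat * nat)) (k : nat) : Prop :=
  exists t, [/\ size t = k, path (fun a b => (a, b) \in arcs) 0 t & last 0 t = 0].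

Lemma loopD arcs k l : loop arcs k -> loop arcs l -> loop arcs (k + l).
Proof.
move=> [t [<- tP t0]] [u [<- uP u0]]; exists (t ++ u).
by rewrite size_cat cat_path last_cat t0 tP uP u0.
Qed.

(** Appending copies of the loop of length [q] leaves only the lengths from [b] to [b + q - 1] to be
    exhibited. *)
Lemma loop_ge arcs b q k :
  0 < q -> loop arcs q -> b <= k -> loop arcs (b + (k - b) %% q) -> loop arcs k.
Proof.
move=> q_gt0 loop_q le_bk loop_r.
rewrite -(subnKC le_bk) {1}(divn_eq (k - b) q) addnCA addnC.
elim: (_ %/ q) => [|j IHj]; first by rewrite addn0.
by rewrite mulSn addnCA; apply: loopD.
Qed.

Lemma loop_closed_walk arcs k : loop arcs k -> exists r : 'I_k -> nat, closed_walk arcs r.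
Proof.
move=> [t [sz_t /(pathP 0) tP t0]]; exists (fun i => nth 0 t i) => -[i lt_ik] /=.
move: (lt_ik); rewrite leq_eqVlt => /predU1P[e|lt_i1k].
  (* [t] omits the initial 0 but ends at 0, so the arc closing the cycle is the first step of the
     path. *)
  rewrite e modnn; have -> : nth 0 t i = 0 by rewrite -[RHS]t0 -nth_last sz_t -e.
  by have := tP 0; apply; rewrite sz_t -e.
by rewrite modn_small // (tP i.+1) // sz_t.
Qed.

(* A loop from 0 of length [l] is a run through the types [0, ..., l - 1]. *)
Definition arcs_of (ls : seq nat) : seq (nat * nat) :=
  [seq (a, a.+1) | a <- iota 0 (foldr maxn 0 ls).-1] ++ [seq (l.-1, 0) | l <- ls].

Lemma valid_scheme_coloring (R : realType) S p lr lc m n :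
  3 <= m -> 3 <= n -> valid_scheme S p (arcs_of lr) (arcs_of lc) ->
  loop (arcs_of lr) m -> loop (arcs_of lc) n ->
  exists c (w : nat -> 'I_m * 'I_n -> R),
    pmd_coloring (cart_prod (cycle_graph m) (cycle_graph n)) p c w.
Proof.
move=> hm hn SP /loop_closed_walk[r rP] /loop_closed_walk[s sP].
exists (scheme_color S r s), (scheme_weight R S r s).
exact: scheme_pmd_coloring SP hm hn rP sP.
Qed.

(** * The two tables and the resulting upper bounds *)

(* Both tables were found by a SAT solver. *)
Definition scheme5 : scheme := {|
  bias := 4;
  hcol :=
   [:: [:: 4; 2; 4; 3; 0; 3];
       [:: 4; 2; 4; 3; 1; 3];
       [:: 4; 2; 4; 3; 4; 3];
       [:: 4; 2; 4; 3; 4; 3];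
       [:: 4; 2; 4; 3; 4; 3];
       [:: 4; 2; 4; 3; 0; 3];
       [:: 4; 2; 0; 3; 4; 3]];
  vcol :=
   [:: [:: 0; 1; 0; 1; 4; 4];
       [:: 2; 3; 1; 0; 2; 0];
       [:: 1; 0; 3; 2; 1; 2];
       [:: 0; 1; 0; 1; 0; 1];
       [:: 1; 0; 3; 2; 1; 2];
       [:: 2; 3; 1; 1; 2; 1];
       [:: 1; 0; 3; 2; 1; 2]];
  wt :=
  [:: [:: [:: 4; 4; 3; 0; 7; 2];
          [:: 5; 0; 6; 2; 0; 3];
          [:: 0; 8; 0; 7; 0; 6];
          [:: 7; 1; 7; 0; 8; 0];
          [:: 2; 6; 2; 3; 1; 4];
          [:: 5; 3; 3; 2; 6; 3];
          [:: 2; 5; 3; 6; 0; 5]];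
      [:: [:: 6; 2; 0; 2; 6; 0];
          [:: 0; 7; 1; 7; 1; 8];
          [:: 8; 0; 8; 0; 7; 0];
          [:: 1; 7; 0; 6; 2; 6];
          [:: 5; 2; 5; 3; 5; 3];
          [:: 4; 4; 3; 4; 4; 4];
          [:: 3; 2; 6; 5; 3; 5]];
      [:: [:: 0; 8; 1; 7; 1; 6];
          [:: 7; 1; 8; 0; 7; 1];
          [:: 2; 6; 3; 5; 3; 5];
          [:: 3; 5; 4; 4; 4; 4];
          [:: 0; 8; 1; 7; 1; 6];
          [:: 5; 3; 6; 2; 5; 3];
          [:: 4; 4; 5; 3; 4; 4]];
      [:: [:: 8; 0; 6; 2; 7; 1];
          [:: 2; 6; 0; 8; 1; 7];
          [:: 5; 3; 3; 5; 4; 4];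
          [:: 8; 0; 6; 2; 7; 1];
          [:: 7; 1; 5; 3; 6; 2];
          [:: 5; 3; 4; 4; 6; 5];
          [:: 2; 6; 5; 8; 1; 7]]]
|}.

Definition scheme6 : scheme := {|
  bias := 5;
  hcol :=
   [:: [:: 3; 2; 5; 1; 5];
       [:: 4; 3; 1; 5; 1];
       [:: 2; 4; 5; 1; 5];
       [:: 3; 5; 2; 5; 2];
       [:: 5; 3; 2; 1; 2]];
  vcol :=
   [:: [:: 2; 5; 0; 4; 0];
       [:: 3; 0; 2; 2; 4];
       [:: 4; 1; 3; 0; 3];
       [:: 0; 4; 1; 3; 4];
       [:: 4; 0; 4; 0; 3]];
  wt :=
  [:: [:: [:: 3; 3; 5; 3; 7];
          [:: 0; 4; 6; 0; 4];
          [:: 0; 7; 0; 10; 0];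
          [:: 9; 0; 0; 1; 1];
          [:: 2; 8; 2; 8; 2]];
      [:: [:: 5; 5; 4; 6; 5];
          [:: 5; 0; 10; 1; 6];
          [:: 2; 8; 0; 9; 4];
          [:: 3; 3; 7; 2; 5];
          [:: 5; 5; 4; 6; 5]];
      [:: [:: 3; 7; 4; 5; 1];
          [:: 8; 0; 10; 2; 4];
          [:: 2; 9; 1; 9; 4];
          [:: 5; 3; 7; 4; 6];
          [:: 7; 3; 6; 5; 4]];
      [:: [:: 6; 5; 3; 7; 4];
          [:: 9; 1; 10; 1; 2];
          [:: 2; 2; 8; 2; 8];
          [:: 6; 5; 3; 4; 3];
          [:: 4; 5; 6; 7; 7]];
      [:: [:: 8; 6; 2; 8; 2];
          [:: 7; 4; 3; 3; 6];
          [:: 3; 4; 7; 2; 5];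
          [:: 8; 5; 5; 1; 9];
          [:: 3; 6; 9; 2; 8]]]
|}.


Lemma torus_odd_even_coloring (R : realType) (m n : nat) :
  3 <= m -> 3 <= n -> odd m -> ~~ odd n ->
  exists c (w : nat -> 'I_m * 'I_n -> R),
    pmd_coloring (cart_prod (cycle_graph m) (cycle_graph n)) 5 c w.
Proof.
move=> hm hn m_odd n_even.
have n_ge4 : 4 <= n by case: n hn n_even => [|[|[|[|n]]]].
(* [valid_scheme] is settled here by computation; the loops remain. *)
apply: (@valid_scheme_coloring R scheme5 5 [:: 3; 5; 7] [:: 4; 6]) => //.
- have loop3 : loop (arcs_of [:: 3; 5; 7]) 3 by exists [:: 1; 2; 0].
  (* Steps of 6 = 3 + 3 preserve parity, so the odd base lengths 3, 5, 7 suffice. *)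
  apply: (loop_ge (q := 6) _ (loopD loop3 loop3) hm) => //.
  have : ~~ odd ((m - 3) %% 6) by rewrite odd_mod // oddB // m_odd.
  case: (_ %% 6) (ltn_pmod (m - 3) (isT : 0 < 6)) => [|[|[|[|[|[|k]]]]]] // _ _.
  + by exists [:: 1; 2; 3; 4; 0].
  + by exists [:: 1; 2; 3; 4; 5; 6; 0].
- have loop4 : loop (arcs_of [:: 4; 6]) 4 by exists [:: 1; 2; 3; 0].
  (* Steps of 4 leave the even base lengths 4 and 6. *)
  apply: (loop_ge (q := 4) _ loop4 n_ge4) => //.
  have : ~~ odd ((n - 4) %% 4) by rewrite odd_mod // oddB // (negbTE n_even).
  case: (_ %% 4) (ltn_pmod (n - 4) (isT : 0 < 4)) => [|[|[|[|k]]]] // _ _.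
  by exists [:: 1; 2; 3; 4; 5; 0].
Qed.

Lemma pmd_torus_le6 (R : realType) (m n : nat) :
  3 <= m -> 3 <= n -> pmd R (cart_prod (cycle_graph m) (cycle_graph n)) <= 6.
Proof.
move=> hm hn.
have loops k : 3 <= k -> loop (arcs_of [:: 3; 4; 5]) k.
  move=> hk; have loop3 : loop (arcs_of [:: 3; 4; 5]) 3 by exists [:: 1; 2; 0].
  apply: (loop_ge (q := 3) _ loop3 hk) => //.
  case: (_ %% 3) (ltn_pmod (k - 3) (isT : 0 < 3)) => [|[|[|j]]] // _.
  - by exists [:: 1; 2; 3; 0].
  - by exists [:: 1; 2; 3; 4; 0].
have [c [w cw]] : exists c (w : nat -> 'I_m * 'I_n -> R),
    pmd_coloring (cart_prod (cycle_graph m) (cycle_graph n)) 6 c w; last first.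
  exact: pmd_coloring_le cw.
by apply: (@valid_scheme_coloring R scheme6 6 [:: 3; 4; 5] [:: 3; 4; 5]) => //; apply: loops.
Qed.

Theorem theorem4p5 (R : realType) (m n : nat) (hm : 3 <= m) (hn : 3 <= n) :
  5 <= pmd R (cart_prod (cycle_graph m) (cycle_graph n)) <= 6 /\
  (odd (m + n) ->
   (m, n) \notin [:: (3, 4); (4, 3); (3, 6); (6, 3); (5, 6); (6, 5)] ->
   pmd R (cart_prod (cycle_graph m) (cycle_graph n)) = 5).
Proof.
split=> [|mn_odd _]; first by rewrite pmd_torus_ge5 ?pmd_torus_le6.
apply/eqP; rewrite eqn_leq pmd_torus_ge5 // andbT.
move: mn_odd; rewrite oddD; have [m_odd|m_even] := boolP (odd m) => /= n_odd.
  have [c [w cw]] := torus_odd_even_coloring R hm hn m_odd n_odd.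
  exact: pmd_coloring_le cw.
have [c [w cw]] := torus_odd_even_coloring R hn hm n_odd m_even.
(* If [n] is the odd length, the colouring of the torus with exchanged factors is pulled back along
   the swap. *)
pose swap (u : 'I_m * 'I_n) := (u.2, u.1).
apply: (pmd_coloring_le (pmd_coloring_pullback (f := swap) _ _ cw)).
  by move=> [i j] [i' j'] [-> ->].
by move=> u v /orP[]/andP[u1 u2]; apply/orP; [right|left]; apply/andP.
Qed.
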